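(* Let $\mathbb{T}$ be a time scale that is unbounded above and has bounded graininess, and let $A(t)\in\mathbb{R}^{n\times n}$, $B(t)\in\mathbb{R}^{n\times m}$, $C(t)\in\mathbb{R}^{p\times n}$ be rd-continuous matrix functions on $\mathbb{T}$ with $A$ regressive. Suppose the regressive linear system $$x^{\Delta}(t)=A(t)x(t)+B(t)u(t),\qquad y(t)=C(t)x(t),$$ is a realization of the weighting pattern $G(t,\sigma(s))$. Then this realization is minimal if and only if for some $t_0\in\mathbb{T}$ and some $t_f\in\mathbb{T}$ with $t_f>t_0$ the state equation is both controllable and observable on $[t_0,t_f]$.
   Context: A time scale $\mathbb{T}$ is a nonempty closed subset of $\mathbb{R}$, with forward jump operator $\sigma(t)=\inf\{s\in\mathbb{T}:s>t\}$ and graininess $\mu(t)=\sigma(t)-t$; $f^\Delta$ denotes the delta derivative. Intervals are understood to be intersected with $\mathbb{T}$. A function is rd-continuous if it is continuous at right-dense points of $\mathbb{T}$ and has finite left limits at left-dense points. A square matrix function $A$ is regressive if $I+\mu(t)A(t)$ is invertible for all $t\in\mathbb{T}$. $\Phi_A(t,s)$ is the transition matrix: the unique solution $X(t)$ of $X^\Delta(t)=A(t)X(t)$, $X(s)=I$. A regressive linear system $x^{\Delta}=A(t)x+B(t)u$, $y=C(t)x$ (rd-continuous coefficients, $A$ regressive, state dimension $n$, zero initial state) is a realization of dimension $n$ of the weighting pattern $G(t,\sigma(s))$ if $G(t,\sigma(s))=C(t)\Phi_A(t,\sigma(s))B(s)$ for all $t,s\in\mathbb{T}$. It is a minimal realization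 if no realization of $G(t,\sigma(s))$ with dimension less than $n$ exists. The system is controllable on $[t_0,t_f]$ if for every initial state $x(t_0)=x_0\in\mathbb{R}^n$ and every prescribed final state $x_f\in\mathbb{R}^n$ there exists an rd-continuous input $u(t)$ such that the corresponding solution satisfies $x(t_f)=x_f$. It is observable on $[t_0,t_f]$ if, with zero input, any initial state $x(t_0)=x_0$ is uniquely determined by the corresponding response $y(t)$ for $t\in[t_0,t_f)$. *)

(* Defs.v *)
From HB Require Import structures.
From mathcomp Require Import all_boot all_order all_algebra.
From mathcomp Require Import all_classical all_reals all_analysis.

Set Implicit Arguments.
Unset Strict Implicit.
Unset Printing Implicit Defensive.

Import Order.TTheory GRing.Theory Num.Theory.
Import numFieldNormedType.Exports.

Local Open Scope classical_set_scope.
Local Open Scope ring_scope.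

(* Functions on a time scale T are represented by total functions on R; every
   notion below depends only on their values at points of T.  Inputs, states
   and coefficients are matrices of arbitrary, possibly zero, size, with the
   norm and topology of 'M[R]_(m, n). *)

Section TimeScale.
Variable R : realType.
Implicit Types (T : set R) (t s : R).

Definition time_scale T := T !=set0 /\ closed T.

(* The usual convention inf set0 = sup T is not implemented: it is only relevant
   at a maximum of T, and [inf set0 = 0] is a junk value.  The time scales of
   interest are unbounded above. *)
Definition sigma T t : R := inf [set s | T s /\ t < s].

Definition rho T t : R := sup [set s | T s /\ s < t].

Definition mu T t : R := sigma T t - t.

Definition bounded_graininess T := exists K : R, forall t, T t -> mu T t <= K.

Definition right_dense T t := T t /\ sigma T t = t.

(* The minimum of T, if any, is not left-dense. *)
Definition left_dense T t :=
  [/\ T t, [set s | T s /\ s < t] !=set0 & rho T t = t].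

Definition rd_continuous T (V : normedModType R) (f : R -> V) :=
  (forall t, right_dense T t -> f @ within T (nbhs t) --> f t) /\
  (forall t, left_dense T t -> exists l : V, f @ within T t^'- --> l).

(* [is_delta_derivative T f t l] means f^Delta(t) = l.  For T unbounded above,
   T^kappa = T, so this makes sense at every point of T. *)
Definition is_delta_derivative T (V : normedModType R) (f : R -> V) t (l : V) :=
  forall e : R, 0 < e ->
    \forall s \near within T (nbhs t),
      `|f (sigma T t) - f s - (sigma T t - s) *: l| <= e * `|sigma T t - s|.

End TimeScale.

Section LinearSystem.
Variable R : realType.
Implicit Types (T : set R) (n m p : nat).

Definition regressive T n (A : R -> 'M[R]_n) :=
  forall t, T t -> 1%:M + mu T t *: A t \in unitmx.

Definition regressive_system T n m p
    (A : R -> 'M[R]_n) (B : R -> 'M[R]_(n, m)) (C : R -> 'M[R]_(p, n)) :=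
  [/\ rd_continuous T A, rd_continuous T B, rd_continuous T C & regressive T A].

(* [Phi t s] is Phi_A(t, s): for each s in T, t |-> Phi t s solves
   X^Delta = A X, X(s) = I.  This determines Phi on T x T when A is rd-continuous
   and regressive. *)
Definition is_transition_matrix T n (A : R -> 'M[R]_n) (Phi : R -> R -> 'M[R]_n) :=
  forall s, T s ->
    Phi s s = 1%:M /\
    forall t, T t -> is_delta_derivative T (fun r => Phi r s) t (A t *m Phi t s).

(* [G t s] is the value written G(t, sigma(s)).  As this value is
   C(t) Phi_A(t, sigma(s)) B(s), it depends on s and not only on sigma(s); a
   function of sigma(s) is the particular case [G t s := G' t (sigma T s)]. *)
Definition realization T n m p
    (A : R -> 'M[R]_n) (B : R -> 'M[R]_(n, m)) (C : R -> 'M[R]_(p, n))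
    (G : R -> R -> 'M[R]_(p, m)) :=
  regressive_system T A B C /\
  exists Phi : R -> R -> 'M[R]_n, is_transition_matrix T A Phi /\
    forall t s, T t -> T s -> G t s = C t *m Phi t (sigma T s) *m B s.

(* Dimension 0 is allowed: it is the dimension of the minimal realization of the
   zero weighting pattern. *)
Definition minimal_realization T n m p
    (A : R -> 'M[R]_n) (B : R -> 'M[R]_(n, m)) (C : R -> 'M[R]_(p, n))
    (G : R -> R -> 'M[R]_(p, m)) :=
  realization T A B C G /\
  forall k : nat, (k < n)%N ->
    ~ exists (A' : R -> 'M[R]_k) (B' : R -> 'M[R]_(k, m))
             (C' : R -> 'M[R]_(p, k)), realization T A' B' C' G.

Definition state_solution T n m
    (A : R -> 'M[R]_n) (B : R -> 'M[R]_(n, m))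
    (u : R -> 'cV[R]_m) (x : R -> 'cV[R]_n) :=
  forall t, T t -> is_delta_derivative T x t (A t *m x t + B t *m u t).

Definition controllable T n m
    (A : R -> 'M[R]_n) (B : R -> 'M[R]_(n, m)) (t0 tf : R) :=
  forall x0 xf : 'cV[R]_n,
    exists (u : R -> 'cV[R]_m) (x : R -> 'cV[R]_n),
      [/\ rd_continuous T u, state_solution T A B u x, x t0 = x0 & x tf = xf].

(* The response is compared on the half-open interval [t0, tf). *)
Definition observable T n m p
    (A : R -> 'M[R]_n) (B : R -> 'M[R]_(n, m)) (C : R -> 'M[R]_(p, n))
    (t0 tf : R) :=
  forall x1 x2 : R -> 'cV[R]_n,
    state_solution T A B (fun=> 0) x1 -> state_solution T A B (fun=> 0) x2 ->
    (forall t, T t -> t0 <= t < tf -> C t *m x1 t = C t *m x2 t) ->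
    x1 t0 = x2 t0.

End LinearSystem.

(* Main.v *)
(* In the coordinates z(t) = Phi(s0, t) x(t) the system reads
   z^Delta = B'(t) u, y = C'(t) z with B'(s) = Phi(s0, sigma(s)) B(s) and
   C'(t) = C(t) Phi(t, s0), and the weighting pattern factors as
   G(t, sigma(s)) = C'(t) B'(s) for all t and s in T.

   If the columns of the B'(s), or the rows of the C'(t), do not span R^n, then
   restricting to their span gives a realization of smaller dimension with
   A = 0.  So minimality forces both to span R^n; finitely many times then
   suffice, and on an interval containing them the system is observable, and
   controllable because its Gramian is invertible.

   Conversely, controllability and observability on one interval imply these
   two spanning conditions.  If C'(t) B'(s) = C''(t) B''(s) through R^k, then
   left multiplication by coefficients expressing the identity in terms of
   finitely many C'(t) gives B'(s) = Y B''(s) with Y an n x k matrix, so that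
   n <= k. *)
Require Import Defs.
From HB Require Import structures.
From mathcomp Require Import all_boot all_order all_algebra.
From mathcomp Require Import all_classical all_reals all_analysis.
From mathcomp Require Import measurable_realfun.
From mathcomp Require Import ring lra.
Import Order.TTheory GRing.Theory Num.Theory.
Import numFieldNormedType.Exports.
Local Open Scope classical_set_scope.
Local Open Scope ring_scope.

Set Implicit Arguments.
Unset Strict Implicit.
Unset Printing Implicit Defensive.

(** * Time scales *)

(** Turns an estimate valid for every [e], as in the definition of the delta derivative, into an
    equality. The case [e = 1] shows that [c] is nonnegative. *)
Lemma normr_le_eps0 (R : realType) (V : normedModType R) (x : V) (c : R) :
  (forall e : R, 0 < e -> `|x| <= e * c) -> x = 0.
Proof.
move=> h; apply/normr0_eq0/eqP; rewrite eq_le normr_ge0 andbT.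
apply/ler_addgt0Pl => e e0; rewrite addr0.
have c0 : 0 <= c by have := h 1 ltr01; rewrite mul1r; apply: le_trans.
have c1 : 0 < c + 1 by lra.
apply: le_trans (h (e / (c + 1)) (divr_gt0 e0 c1)) _.
by rewrite -mulrA ger_pMr// mulrC ler_pdivrMr//; lra.
Qed.

Lemma near_withinP (R : realType) (T : set R) (t : R) (P : set R) :
  (\forall s \near within T (nbhs t), P s) <->
  exists2 d : R, 0 < d & forall s, T s -> `|s - t| < d -> P s.
Proof.
split.
  move=> /nbhs_ballP[d /= d0 h]; exists d => // s Ts sd.
  by apply: h => //=; rewrite /ball /= distrC.
move=> [d d0 h]; apply/nbhs_ballP; exists d => //= s sd Ts.
by apply: h => //; rewrite distrC.
Qed.

Lemma cvg_withinP (R : realType) (V : normedModType R) (T : set R) (f : R -> V)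
    (t : R) (l : V) :
  f @ within T (nbhs t) --> l <->
  forall e : R, 0 < e ->
    exists2 d : R, 0 < d & forall s, T s -> `|s - t| < d -> `|l - f s| <= e.
Proof.
split=> [/cvgrPdist_le h e e0|h]; first exact/near_withinP/h.
by apply/cvgrPdist_le => e e0; apply/near_withinP/h.
Qed.

(** A limit point of the set lies in [T] because [T] is closed, so continuity relative to [T]
    applies there. This supplies the closed sets for real induction along [T]. *)
Lemma closed_preimage_within {R : realType} {V : normedModType R} {T : set R}
    {f : R -> V} {D : set V} :
  closed T -> (forall t, T t -> f @ within T (nbhs t) --> f t) -> closed D ->
  closed (T `&` f @^-1` D).
Proof.
move=> Tcl fc Dcl t clt.
have Tt : T t.
  by apply: Tcl => U /clt [s [[Ts _] Us]]; exists s.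
split=> //; apply: Dcl => U Uft.
have := fc _ Tt _ Uft => /nbhs_ballP[d /= d0 h].
have [s [[Ts Ds] sd]] := clt _ (nbhsx_ballx t d d0).
by exists (f s); split => //; exact: h.
Qed.

(* The supremum of P in [a, b] lies in P, so it is b. *)
Lemma closed_real_induction (R : realType) (P : set R) (a b : R) :
  closed P -> a <= b -> P a ->
  (forall c, P c -> a <= c < b -> exists r, [/\ P r, c < r & r <= b]) -> P b.
Proof.
move=> Pcl ab Pa step.
pose S := P `&` [set t | t <= b].
have Sa : S a by [].
have Sne : S !=set0 by exists a.
have Sub : ubound S b by move=> t [].
have Scl : closed S by apply: closedI => //; exact: closed_le.
have hs : has_sup S by split => //; exists b.
have [Pc cb] : S (sup S).
  apply: Scl => U /nbhs_ballP[d /= d0 h].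
  have [s Ss sd] := sup_adherent d0 hs.
  exists s; split => //; apply: h; rewrite /ball /=.
  have := ub_le_sup (ex_intro _ b Sub) Ss.
  by move=> ?; rewrite ger0_norm; lra.
have ac : a <= sup S by apply: ub_le_sup => //; exists b.
have [cb'|bc] := ltP (sup S) b; last by have <- : sup S = b by apply/le_anti/andP.
have [r [Pr cr rb]] := step _ Pc (introT andP (conj ac cb')).
have : r <= sup S by apply: ub_le_sup; [exists b|split].
by rewrite leNgt cr.
Qed.

(** Reflection of the upward principle through [t |-> - t]. *)
Lemma closed_real_induction_down (R : realType) (P : set R) (a b : R) :
  closed P -> a <= b -> P b ->
  (forall c, P c -> a < c <= b -> exists r, [/\ P r, a <= r & r < c]) -> P a.
Proof.
move=> Pcl ab Pb step; rewrite -[a]opprK.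
apply: (@closed_real_induction R [set t | P (- t)] (- b)) => //=.
- apply: preimage_closed Pcl => t _; exact: opp_continuous.
- by rewrite lerN2.
- by rewrite opprK.
- move=> c Pc /andP[bc ca].
  have [|r [Pr ar rc]] := step _ Pc; first by lra.
  by exists (- r); rewrite opprK; split => //; lra.
Qed.

(** * The forward jump operator and the points just to the left of a point *)

Section JumpOperator.
Variables (R : realType) (T : set R).
Hypotheses (Tcl : closed T) (Tunb : ~ has_ubound T).
Implicit Types t s : R.

Lemma unbounded_gt t : exists2 s, T s & t < s.
Proof.
apply: contrapT => h; apply: Tunb; exists t => s Ts.
by rewrite leNgt; apply/negP => ts; apply: h; exists s.
Qed.

Let later t := [set s | T s /\ t < s].

Let later_has_inf t : has_inf (later t).
Proof.
split; first by have [s] := unbounded_gt t; exists s.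
by exists t => s [_ /ltW].
Qed.

Lemma sigma_ge t : t <= sigma T t.
Proof. by apply: lb_le_inf; [case: (later_has_inf t)|move=> s [_ /ltW]]. Qed.

Lemma sigma_le t s : T s -> t < s -> sigma T t <= s.
Proof. by move=> Ts ts; apply: ge_inf => //; case: (later_has_inf t). Qed.

Lemma sigma_adherent t e : 0 < e -> exists s, [/\ T s, t < s & s < sigma T t + e].
Proof.
by move=> e0; have [s [Ts ts] se] := inf_adherent e0 (later_has_inf t); exists s.
Qed.

Lemma sigma_mem t : T (sigma T t).
Proof.
apply: Tcl => U /nbhs_ballP[d /= d0 h].
have [s [Ts ts sd]] := sigma_adherent t d0.
exists s; split => //; apply: h; rewrite /ball /=.
by have := sigma_le Ts ts; move=> ?; rewrite ler0_norm; lra.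
Qed.

Lemma mu_ge0 t : 0 <= mu T t.
Proof. by rewrite /mu subr_ge0 sigma_ge. Qed.

Let earlier t := [set s | T s /\ s < t].

(** Minimum of [T], left-scattered point, or left-dense point. In the second case the predecessor is
    [rho T t]. These are the moves open to a downward induction. *)
Lemma left_cases t : T t ->
  [\/ forall s, T s -> t <= s,
      exists r, [/\ T r, r < t & sigma T r = t] |
      left_dense T t /\
      forall e, 0 < e -> exists s, [/\ T s, t - e < s & s < t]].
Proof.
move=> Tt.
have [E0|E0] := pselect (exists s, earlier t s); last first.
  by apply: Or31 => s Ts; rewrite leNgt; apply/negP => st; apply: E0; exists s.
have hs : has_sup (earlier t) by split => //; exists t => s [_ /ltW].
have ub : ubound (earlier t) (rho T t) by move=> s Es; apply: ub_le_sup => //; case: hs.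
have le : rho T t <= t by apply: ge_sup => // s [_ /ltW].
have Tr : T (rho T t).
  apply: Tcl => U /nbhs_ballP[d /= d0 h].
  have [s Es sd] := sup_adherent d0 hs.
  exists s; split; [by case: Es|apply: h; rewrite /ball /=].
  by have := ub _ Es; rewrite /rho in sd * => ?; rewrite ger0_norm; lra.
have [rt|tr] := ltP (rho T t) t.
  apply: Or32; exists (rho T t); split => //.
  apply/le_anti/andP; split; first exact: sigma_le.
  rewrite leNgt; apply/negP => st.
  have d0 : 0 < t - sigma T (rho T t) by lra.
  have [s [Ts rs se]] := sigma_adherent (rho T t) d0.
  have /ub : earlier t s by split => //; lra.
  by rewrite leNgt rs.
have eq : rho T t = t by apply/le_anti/andP.
apply: Or33; split; first by split.
move=> e e0; have [s [Ts st] sd] := sup_adherent e0 hs.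
by exists s; split => //; move: sd; rewrite -/(rho T t) eq.
Qed.

End JumpOperator.

(** * Delta derivatives *)

Lemma norm_mx_le (R : realType) m n (M : 'M[R]_(m, n)) e : 0 <= e ->
  `|M| <= e <-> forall i j, `|M i j| <= e.
Proof.
move=> e0; rewrite {1}/Num.norm/= mx_normrE; split.
  by move=> h i j; apply: le_trans h; exact: (le_bigmax _ _ (i, j)).
by move=> h; apply: bigmax_le => // -[i j] _; exact: h.
Qed.

Section DeltaDerivative.
Variables (R : realType) (T : set R).
Hypotheses (Tcl : closed T) (Tunb : ~ has_ubound T).
Implicit Types (t s : R) (V : normedModType R).

(** The point [s = t] lies in every neighbourhood of [t], so the defining estimate holds there for
    all [e]. *)
Lemma delta_step {V} {f : R -> V} {t l} : T t ->
  is_delta_derivative T f t l -> f (sigma T t) = f t + mu T t *: l.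
Proof.
move=> Tt h; apply/eqP; rewrite -subr_eq0 opprD addrA; apply/eqP.
apply: (@normr_le_eps0 _ _ _ `|sigma T t - t|) => e e0.
have /near_withinP[d d0 hd] := h e e0.
by apply: hd => //; rewrite subrr normr0.
Qed.

(** The jump formula eliminates [f (sigma T t)] and leaves the ordinary first-order error at [t],
    still measured against [sigma T t - s]. *)
Lemma is_delta_derivativeP {V} {f : R -> V} {t l} : T t ->
  is_delta_derivative T f t l <->
  f (sigma T t) = f t + mu T t *: l /\
  forall e, 0 < e -> exists2 d, 0 < d & forall s, T s -> `|s - t| < d ->
    `|f t - f s - (t - s) *: l| <= e * `|sigma T t - s|.
Proof.
move=> Tt.
have E s : f (sigma T t) = f t + mu T t *: l ->
    f (sigma T t) - f s - (sigma T t - s) *: l = f t - f s - (t - s) *: l.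
  move=> ->; rewrite (_ : sigma T t - s = mu T t + (t - s)); last by rewrite /mu; ring.
  by rewrite (scalerDl _ (mu T t)) opprD addrA; congr (_ - _); rewrite addrAC addrK.
split=> [h|[st h] e e0]; last first.
  by apply/near_withinP; have [d d0 hd] := h e e0; exists d => // s Ts sd; rewrite E ?hd.
have st := delta_step Tt h; split => // e e0.
have /near_withinP[d d0 hd] := h e e0.
by exists d => // s Ts sd; rewrite -E//; exact: hd.
Qed.

Lemma delta_cvg {V} {f : R -> V} {t l} : T t ->
  is_delta_derivative T f t l -> f @ within T (nbhs t) --> f t.
Proof.
move=> Tt /(is_delta_derivativeP Tt)[_ h]; apply/cvg_withinP => e e0.
have M0 := mu_ge0 Tunb t; set M := mu T t in M0.
have L0 := normr_ge0 l; set L := `|l| in L0.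
(* The derivative estimate will cost at most [e / (2 * K) * (M + 1)] and the linear term at most
   [e / (2 * K) * L]; together they make half of [e]. *)
pose K := M + 1 + L.
have K0 : 0 < K by rewrite /K; lra.
have [d d0 hd] := h (e / (2 * K)) (divr_gt0 e0 (mulr_gt0 (ltr0n _ 2) K0)).
exists (Num.min d (Num.min 1 (e / (2 * K)))).
  by rewrite !lt_min d0 ltr01 divr_gt0// mulr_gt0.
move=> s Ts; rewrite !lt_min => /and3P[sd s1 se].
have st : `|t - s| = `|s - t| by rewrite distrC.
rewrite -(subrK ((t - s) *: l) (f t - f s)) (le_trans (ler_normD _ _))//.
rewrite normrZ st -/L.
have := hd s Ts sd.
have : `|sigma T t - s| <= M + 1.
  rewrite -(subrKA t) (le_trans (ler_normD _ _))// -/(mu T t) -/M.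
  by rewrite (ger0_norm M0) st lerD2l ltW.
set X := `|sigma T t - s|; set Y := `|s - t| in se s1 *; move=> XM.
move=> /le_trans bound.
have -> : e = e / (2 * K) * (M + 1) + (e / (2 * K) * L + e / 2).
  by rewrite /K; field; rewrite lt0r_neq0// -/K.
have q0 : 0 < e / (2 * K) by rewrite divr_gt0// mulr_gt0.
rewrite lerD//; first by apply: bound; rewrite ler_pM2l.
apply: (@le_trans _ _ (e / (2 * K) * L)); first by rewrite ler_wpM2r// ltW.
by rewrite lerDl divr_ge0// ltW.
Qed.

Lemma delta_cst V (c : V) t : is_delta_derivative T (fun=> c) t 0.
Proof.
move=> e e0; apply: nearW => s.
by rewrite scaler0 !subrr normr0 mulr_ge0// ltW.
Qed.

Lemma deltaD {V} {f g : R -> V} {t l k} :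
  is_delta_derivative T f t l -> is_delta_derivative T g t k ->
  is_delta_derivative T (f \+ g) t (l + k).
Proof.
move=> hf hg e e0; have e2 : 0 < e / 2 by rewrite divr_gt0.
have /near_withinP[d d0 hd] := hf _ e2.
have /near_withinP[d' d'0 hd'] := hg _ e2.
apply/near_withinP; exists (Num.min d d'); first by rewrite lt_min d0.
move=> s Ts; rewrite lt_min => /andP[sd sd'] /=.
rewrite scalerDr (_ : _ - _ = (f (sigma T t) - f s - (sigma T t - s) *: l) +
  (g (sigma T t) - g s - (sigma T t - s) *: k)); last first.
  by rewrite 2!opprD (addrACA (f _)) [LHS]addrACA.
rewrite (le_trans (ler_normD _ _))// [e]splitr mulrDl.
by rewrite lerD//; [exact: hd|exact: hd'].
Qed.

Lemma delta_sum {V} {I : Type} {r : seq I} {f : I -> R -> V} {t} {l : I -> V} :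
  (forall i, is_delta_derivative T (f i) t (l i)) ->
  is_delta_derivative T (fun x => \sum_(i <- r) f i x) t (\sum_(i <- r) l i).
Proof.
move=> h; elim: r => [|i r IH].
  rewrite big_nil [X in is_delta_derivative _ X](_ : _ = fun=> 0).
    exact: delta_cst.
  by apply/funext => x; rewrite big_nil.
rewrite big_cons [X in is_delta_derivative _ X](_ : _ = f i \+ fun x => \sum_(j <- r) f j x).
  exact: deltaD.
by apply/funext => x; rewrite big_cons.
Qed.

Lemma deltaM {f g : R -> R^o} {t l k} : T t ->
  is_delta_derivative T f t l -> is_delta_derivative T g t k ->
  is_delta_derivative T (f \* g : R -> R^o) t (l * g t + f (sigma T t) * k).
Proof.
move=> Tt hf hg e e0.
(* The three summands of [K] weight the three terms into which the error is split below; [+ 1] lets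
   [g s] differ from [g t] by at most 1 near [t]. *)
pose K := (`|g t| + 1) + `|l| + `|f (sigma T t)|.
have K0 : 0 < K by rewrite /K; have := normr_ge0 (g t); have := normr_ge0 l;
  have := normr_ge0 (f (sigma T t)); lra.
have q0 : 0 < e / K by rewrite divr_gt0.
have /near_withinP[d d0 hd] := hf _ q0.
have /near_withinP[d' d'0 hd'] := hg _ q0.
have q1 : 0 < Num.min 1 (e / K) by rewrite lt_min ltr01.
have /cvg_withinP/(_ _ q1)[d'' d''0 hd''] := delta_cvg Tt hg.
apply/near_withinP; exists (Num.min d (Num.min d' d'')); first by rewrite !lt_min d0 d'0.
move=> s Ts; rewrite !lt_min => /and3P[{}/hd sd {}/hd' sd' {}/hd'' sd''] /=.
move: sd sd' sd'' => /(_ Ts) sd /(_ Ts) sd' /(_ Ts).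
rewrite le_min => /andP[g1 gK].
have gs : `|g s| <= `|g t| + 1.
  rewrite -(subKr (g t) (g s)) (le_trans (ler_normD _ _))//.
  by rewrite normrN lerD2l.
have -> : f (sigma T t) * g (sigma T t) - f s * g s - (sigma T t - s) *: (l * g t + f (sigma T t) * k) =
   (f (sigma T t) - f s - (sigma T t - s) *: l) * g s + (sigma T t - s) * l * (g s - g t) +
   f (sigma T t) * (g (sigma T t) - g s - (sigma T t - s) *: k).
  by rewrite /GRing.scale /=; ring.
have -> : e * `|sigma T t - s| = (e / K * `|sigma T t - s|) * (`|g t| + 1)
    + (`|sigma T t - s| * `|l| * (e / K)) + `|f (sigma T t)| * (e / K * `|sigma T t - s|).
  transitivity ((e / K * K) * `|sigma T t - s|); first by rewrite divfK// gt_eqF.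
  by rewrite {2}/K; ring.
rewrite (le_trans (ler_normD _ _))// lerD//.
  rewrite (le_trans (ler_normD _ _))// lerD//.
  - by rewrite normrM ler_pM.
  - by rewrite !normrM ler_pM ?mulr_ge0// distrC.
by rewrite normrM ler_pM.
Qed.

Lemma delta_mxP m n (f : R -> 'M[R]_(m, n)) t l :
  is_delta_derivative T f t l <->
  forall i j, is_delta_derivative T (fun x => f x i j : R^o) t (l i j).
Proof.
split=> [h i j e e0|h e e0].
  have /near_withinP[d d0 hd] := h e e0.
  apply/near_withinP; exists d => // s Ts sd.
  have := hd s Ts sd => /norm_mx_le.
  by move=> /(_ (mulr_ge0 (ltW e0) (normr_ge0 _)) i j); rewrite !mxE.
have : \forall s \near within T (nbhs t), forall i j,
    `|f (sigma T t) i j - f s i j - (sigma T t - s) *: (l i j : R^o)| <= e * `|sigma T t - s|.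
  by do 2 (apply: filter_forall => ?); exact: h.
apply: filterS => s hs; apply/norm_mx_le; first by rewrite mulr_ge0// ltW.
by move=> i j; rewrite !mxE; exact: hs.
Qed.

Lemma delta_mulmx m n p (f : R -> 'M[R]_(m, n)) (g : R -> 'M[R]_(n, p)) t l k :
  T t -> is_delta_derivative T f t l -> is_delta_derivative T g t k ->
  is_delta_derivative T (fun x => f x *m g x) t (l *m g t + f (sigma T t) *m k).
Proof.
move=> Tt /delta_mxP hf /delta_mxP hg; apply/delta_mxP => i j.
rewrite [X in is_delta_derivative _ X](_ : _ =
  fun x => \sum_h (f x i h * g x h j)); last by apply/funext => x; rewrite mxE.
rewrite !mxE -big_split /=.
apply: (@delta_sum R^o _ _ (fun h x => f x i h * g x h j) t
  (fun h => l i h * g t h j + f (sigma T t) i h * k h j)) => h.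
exact: (deltaM Tt (hf i h) (hg h j)).
Qed.

Lemma delta_mulmxr m n p (K : 'M[R]_(n, p)) (f : R -> 'M[R]_(m, n)) t l :
  T t -> is_delta_derivative T f t l -> is_delta_derivative T (fun x => f x *m K) t (l *m K).
Proof.
move=> Tt hf; have := delta_mulmx Tt hf (delta_cst K t).
by rewrite mulmx0 addr0.
Qed.

Lemma delta_mulmxl m n p (K : 'M[R]_(m, n)) (f : R -> 'M[R]_(n, p)) t l :
  T t -> is_delta_derivative T f t l -> is_delta_derivative T (fun x => K *m f x) t (K *m l).
Proof.
move=> Tt hf; have := delta_mulmx Tt (delta_cst K t) hf.
by rewrite mul0mx add0r.
Qed.

(** Real induction on the points where [g t - g a <= (L + e) * (t - a)]. A right-scattered point
    moves to its jump; at a right-dense point the slack [e] absorbs the error of the derivative. *)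
Lemma delta_le_mvt (g g' : R -> R^o) (L a b : R) :
  (forall t, T t -> is_delta_derivative T g t (g' t)) ->
  T a -> T b -> a <= b ->
  (forall t, T t -> a <= t < b -> g' t <= L) -> g b - g a <= L * (b - a).
Proof.
move=> hg Ta Tb ab gL.
apply/ler_addgt0Pr => e0 e0_gt0.
have c1 : 0 < b - a + 1 by lra.
(* Chosen so that [e * (b - a) <= e0]; the [+ 1] covers [a = b]. *)
pose e := e0 / (b - a + 1).
have e_gt0 : 0 < e by rewrite divr_gt0.
pose f (t : R) : R^o := g t - g a - (L + e) * (t - a).
suff : (T `&` f @^-1` [set x | x <= 0]) b.
  move=> [_]; rewrite /= /f => fb.
  have : e * (b - a) <= e0.
    by rewrite -mulrA ger_pMr// mulrC ler_pdivrMr//; lra.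
  by lra.
have fc t : T t -> f @ within T (nbhs t) --> f t.
  move=> Tt; apply: (@cvgB _ R^o); first apply: (@cvgB _ R^o).
  - exact: delta_cvg Tt (hg t Tt).
  - exact: cvg_cst.
  - apply: cvg_within_filter; apply: (@cvgM R); first exact: cvg_cst.
    by apply: (@cvgB _ R^o); [exact: cvg_id|exact: cvg_cst].
apply: (@closed_real_induction _ _ a) => //.
- apply: closed_preimage_within => //; exact: closed_le.
- by split => //=; rewrite /f !subrr mulr0 subr0.
move=> c [Tc /= fc0] /andP[ac cb].
have /near_withinP[d d0 hd] := hg c Tc e e_gt0.
have := gL c Tc; rewrite ac cb => /(_ isT) gcL.
have [sc|cs] := ltP c (sigma T c).
  exists (sigma T c); split => //; last exact: sigma_le.
  split; first exact: sigma_mem.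
  rewrite /= /f (delta_step Tc (hg c Tc)) /mu /GRing.scale /=.
  by move: fc0; rewrite /f => fc0; nra.
have sE : sigma T c = c by apply/le_anti; rewrite cs sigma_ge.
have md : 0 < Num.min d (b - c) by rewrite lt_min d0 subr_gt0.
have [r [Tr cr rd]] := sigma_adherent Tunb c md.
move: rd; rewrite sE addrC -ltrBlDr lt_min => /andP[rd rb].
exists r; split => //; last by lra.
split => //=.
have := hd r Tr; rewrite gtr0_norm ?subr_gt0// => /(_ rd).
rewrite sE /GRing.scale /= [X in _ <= e * X]distrC [X in _ <= e * X]gtr0_norm ?subr_gt0//.
rewrite ler_norml => /andP[]; move: fc0; rewrite /f => fc0.
by nra.
Qed.

(** The matrix norm is the largest absolute value of an entry, so the scalar inequality is applied
    to each entry and to its negative. *)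
Lemma delta_norm_mvt m n (x x' : R -> 'M[R]_(m, n)) (L a b : R) :
  (forall t, T t -> is_delta_derivative T x t (x' t)) ->
  T a -> T b -> a <= b -> 0 <= L ->
  (forall t, T t -> a <= t < b -> `|x' t| <= L) -> `|x b - x a| <= L * (b - a).
Proof.
move=> hx Ta Tb ab L0 hL; apply/norm_mx_le; first by rewrite mulr_ge0// subr_ge0.
move=> i j; rewrite !mxE ler_norml.
have hij t : T t -> is_delta_derivative T (fun x0 => x x0 i j : R^o) t (x' t i j).
  by move=> /hx /delta_mxP.
have bd t : T t -> a <= t < b -> `|x' t i j| <= L.
  by move=> Tt tab; move/(norm_mx_le _ L0) : (hL t Tt tab).
apply/andP; split; last first.
  apply: (delta_le_mvt hij) => // t Tt tab.
  exact: le_trans (ler_norm _) (bd t Tt tab).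
rewrite lerNl opprB.
have hN t : T t -> is_delta_derivative T (fun s => - x s i j : R^o) t (- x' t i j).
  move=> Tt e e0; move: (hij t Tt e e0); apply: filterS => s.
  by rewrite /GRing.scale /= -normrN !(opprD, opprK, mulrN).
have := delta_le_mvt (L := L) hN Ta Tb ab.
rewrite opprK [X in X <= _]addrC; apply => t Tt tab.
by have := bd t Tt tab; rewrite ler_norml => /andP[]; lra.
Qed.

Lemma delta0_cst m n (x : R -> 'M[R]_(m, n)) (s t : R) :
  (forall t, T t -> is_delta_derivative T x t 0) -> T s -> T t -> x s = x t.
Proof.
move=> hx.
suff h a b : a <= b -> T a -> T b -> x a = x b.
  by move=> Ts Tt; have [st|/ltW ts] := leP s t; [exact: h|rewrite -(h _ _ ts)].
move=> ab Ta Tb; apply/esym/eqP; rewrite -subr_eq0 -normr_le0.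
have := delta_norm_mvt hx Ta Tb ab (lexx 0).
by rewrite mul0r; apply => ? _ _; rewrite normr0.
Qed.

End DeltaDerivative.

(** * Delta antiderivatives *)

(* g is the pointwise limit of the step functions obtained by rounding x up to
   the next point of c + N / (n + 1). *)
Lemma right_continuous_measurable (R : realType) (g : R -> R) (c : R) :
  (forall x, c <= x -> forall e, 0 < e -> exists2 d, 0 < d &
     forall y, x <= y < x + d -> `|g x - g y| <= e) ->
  measurable_fun `[c, +oo[ g.
Proof.
move=> rc.
pose h n x := c + (Num.truncn ((x - c) * n.+1%:R)).+1%:R / n.+1%:R.
have n0 n : 0 < n.+1%:R :> R by rewrite ltr0n.
have itvE n k x : c <= x -> (Num.truncn ((x - c) * n.+1%:R) = k) <->
    c + k%:R / n.+1%:R <= x < c + k.+1%:R / n.+1%:R.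
  move=> cx; have xc0 : 0 <= (x - c) * n.+1%:R by rewrite mulr_ge0// subr_ge0.
  rewrite -lerBrDl -ltrBlDl ler_pdivrMr// ltr_pdivlMr//.
  by split=> [<-|/truncn_def//]; exact: truncn_itv.
apply: (@measurable_fun_cvg _ _ _ _ (fun n => g \o h n)); last first.
  move=> x /=; rewrite in_itv/= andbT => cx.
  apply/cvgrPdist_le => e e0; have [d d0 hd] := rc x cx e e0.
  (* [h n x] lies to the right of [x], at distance at most [1 / (n + 1)], so right continuity is
     enough. *)
  near=> n; apply: hd.
  have /itvE-/(_ cx)/andP[h1 h2] : Num.truncn ((x - c) * n.+1%:R) = Num.truncn ((x - c) * n.+1%:R) by [].
  rewrite /h (ltW h2)/= (@le_lt_trans _ _ (x + n.+1%:R^-1))//.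
    by rewrite -natr1 mulrDl mul1r addrA lerD2r.
  rewrite ltrD2l -[ltRHS]invrK ltf_pV2 ?posrE ?invr_gt0//.
  rewrite (@le_lt_trans _ _ n%:R)//; last by rewrite ltr_nat.
  by near: n; exact: nbhs_infty_ger.
move=> n mD Y mY.
(* The step function has one value on each grid interval, so the preimage of [Y] is a countable
   union of such intervals. *)
pose B k := if `[< Y (g (c + k.+1%:R / n.+1%:R)) >]
            then `[c + k%:R / n.+1%:R, c + k.+1%:R / n.+1%:R[%classic else set0.
rewrite (_ : _ `&` _ = \bigcup_k B k).
  by apply: bigcupT_measurable => k; rewrite /B; case: ifP => _.
apply/seteqP; split=> [x [] /=|x [k _]].
  rewrite in_itv/= andbT => cx Yx; exists (Num.truncn ((x - c) * n.+1%:R)) => //.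
  rewrite /B; case: ifPn => [_ /=|/asboolPn//].
  by rewrite in_itv/=; apply/itvE.
rewrite /B; case: ifP => // /asboolP Yk /=; rewrite in_itv/= => xk.
have cx : c <= x.
  by case/andP: xk => + _; apply: le_trans; rewrite lerDl divr_ge0.
by rewrite in_itv/= cx; split => //=; rewrite /h (proj2 (itvE _ _ _ cx) xk).
Unshelve. all: by end_near. Qed.

Section DeltaAntiderivative.
Variables (R : realType) (T : set R).
Hypotheses (Tcl : closed T) (Tunb : ~ has_ubound T).
Implicit Types t s : R.

(** Continuity gives the bound at a right-dense point. At a right-scattered point no point of [T]
    follows before the jump, and the left side is bounded by the left limit or is empty near [t]. *)
Lemma rd_locally_bounded (V : normedModType R) (f : R -> V) t : rd_continuous T f ->
  exists2 d, 0 < d & exists2 K, 0 < K & forall s, T s -> `|s - t| < d -> `|f s| <= K.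
Proof.
move=> [frd fld].
have [Tt|nTt] := pselect (T t); last first.
  have : nbhs t (~` T) by apply: open_nbhs_nbhs; split => //; exact: closed_openC.
  move=> /nbhs_ballP[d /= d0 hd]; exists d => //; exists 1 => // s Ts sd.
  by exfalso; apply: (hd s) => //; rewrite /ball /= distrC.
have [cs|ts] := leP (sigma T t) t.
  have sE : sigma T t = t by apply/le_anti; rewrite cs sigma_ge.
  have /cvg_withinP/(_ 1 ltr01)[d d0 hd] := frd t (conj Tt sE).
  exists d => //; exists (1 + `|f t|) => [|s Ts sd]; first by rewrite ltr_pwDl.
  rewrite -[f s](subrK (f t)) (le_trans (ler_normD _ _))// lerD2r distrC.
  exact: hd.
have [K K0 [d d0 hd]] : exists2 K, 0 < K & exists2 d, 0 < d &
    forall s, T s -> t - d < s < t -> `|f s| <= K.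
  have [h|[r [Tr rt sr]]|[ld _]] := left_cases Tcl Tunb Tt.
  - by exists 1 => //; exists 1 => // s /h ts' /andP[_]; rewrite ltNge ts'.
  - exists 1 => //; exists (t - r); first by rewrite subr_gt0.
    move=> s Ts; rewrite subKr => /andP[rs st].
    by have := sigma_le Tunb Ts rs; rewrite sr leNgt st.
  - have [l /cvgrPdist_le/(_ 1 ltr01)] := fld t ld.
    move=> /nbhs_ballP[d /= d0 hd].
    exists (1 + `|l|); first by rewrite ltr_pwDl.
    exists d => // s Ts /andP[ds st].
    rewrite -[f s](subrK l) (le_trans (ler_normD _ _))// lerD2r distrC.
    by apply: hd => //; rewrite /ball /= gtr0_norm; lra.
exists (Num.min d (sigma T t - t)); first by rewrite lt_min d0 subr_gt0.
exists (K + `|f t|); first by rewrite ltr_pwDl.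
move=> s Ts; rewrite lt_min => /andP[sd st].
have [{}st|ts'|->] := ltgtP s t.
- rewrite (le_trans (hd s Ts _)) ?lerDl//.
  by move: sd; rewrite ltr_norml; lra.
- have := sigma_le Tunb Ts ts'; move: st; rewrite ltr_norml; lra.
- by rewrite lerDr ltW.
Qed.

(** Compactness of [[a, b]] makes the local bounds uniform. *)
Lemma rd_bounded (V : normedModType R) (f : R -> V) a b : rd_continuous T f ->
  exists2 K, 0 < K & forall s, T s -> a <= s <= b -> `|f s| <= K.
Proof.
move=> frd.
have /compact_near_coveringP/(_ _ (@pinfty_nbhs R) (fun K s => T s -> `|f s| <= K) _) :=
  segment_compact (a := a) (b := b).
case=> [x _|K0 [_ hK]].
  have [d d0 [K K0 hd]] := rd_locally_bounded x frd.
  exists (ball x d, [set k | K < k]).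
    split; first exact: nbhsx_ballx.
    by exists K; split; [exact: num_real|move=> k].
  move=> [s k] /= [sd Kk] Ts; rewrite (le_trans (hd s Ts _))// ?ltW//.
  by rewrite distrC.
exists (`|K0| + 1) => [|s Ts sab]; first by rewrite ltr_pwDr.
by apply: hK => //; rewrite ltr_pwDr// ler_norm.
Qed.

(** Meaningful when some point of [T] is at most [x]. Composition with it extends a function from
    [T] across the gaps, so that Lebesgue integration applies. *)
Definition tsfloor (x : R) := sup [set s | T s /\ s <= x].

Lemma tsfloorP c x : T c -> c <= x ->
  [/\ T (tsfloor x), c <= tsfloor x <= x & forall s, T s -> s <= x -> s <= tsfloor x].
Proof.
move=> Tc cx.
have hs : has_sup [set s | T s /\ s <= x] by split; [exists c|exists x => s []].
have ub s : T s -> s <= x -> s <= tsfloor x.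
  by move=> Ts sx; apply: ub_le_sup => //; case: hs.
have le : tsfloor x <= x by apply: ge_sup => [|s []//]; case: hs.
split => //; last by rewrite le ub.
apply: Tcl => U /nbhs_ballP[d /= d0 h].
have [s [Ts sx] sd] := sup_adherent d0 hs.
exists s; split => //; apply: h; rewrite /ball /=.
by have := ub s Ts sx; rewrite /tsfloor in sd * => ?; rewrite ger0_norm; lra.
Qed.

Lemma tsfloor_eq t x : T t -> t <= x -> x < sigma T t \/ x = t -> tsfloor x = t.
Proof.
move=> Tt tx xs; have [Tf /andP[tf fx] _] := tsfloorP Tt tx.
apply/le_anti; rewrite tf andbT; case: xs => [xs|<-//].
rewrite leNgt; apply/negP => tlt.
by have := le_lt_trans (le_trans (sigma_le Tunb Tf tlt) fx) xs; rewrite ltxx.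
Qed.

(** Inside a gap [tsfloor] is constant to the right of [x]. Otherwise [x] is itself a right-dense
    point of [T], where [f] is continuous. *)
Lemma tsfloor_right_continuous (f : R -> R^o) c x : rd_continuous T f ->
  T c -> c <= x -> forall e, 0 < e -> exists2 d, 0 < d &
    forall y, x <= y < x + d -> `|f (tsfloor x) - f (tsfloor y)| <= e.
Proof.
move=> [frd _] Tc cx e e0.
have [Tp /andP[cp px] pmax] := tsfloorP Tc cx.
set p := tsfloor x in Tp cp px pmax *.
have [xs|sx] := ltP x (sigma T p).
  exists (sigma T p - x) => [|y /andP[xy yd]]; first by rewrite subr_gt0.
  rewrite (tsfloor_eq Tp (le_trans px xy)) ?subrr ?normr0 ?ltW//.
  by left; lra.
have sp := pmax _ (sigma_mem Tcl Tunb p) sx.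
have sE : sigma T p = p by apply/le_anti; rewrite sp sigma_ge.
have xp : x = p.
  apply/le_anti; rewrite px andbT leNgt; apply/negP => plt.
  have d0 : 0 < x - p by rewrite subr_gt0.
  have [s [Ts ps]] := sigma_adherent Tunb p d0.
  by rewrite sE subrKC => /ltW /(pmax _ Ts); rewrite leNgt ps.
have /cvg_withinP/(_ e e0)[d d0 hd] := frd p (conj Tp sE).
exists d => // y /andP[xy yd].
have [Tq /andP[pq qy] _] := tsfloorP Tp (le_trans px xy).
by apply: hd => //; rewrite ger0_norm; lra.
Qed.

(* The function [f \o tsfloor], which equals f t on [t, sigma t), is
   right-continuous, and its Lebesgue integral over [s, t) for s, t in T is the
   delta integral of f. *)
Lemma rd_antiderivative (f : R -> R^o) : T !=set0 -> rd_continuous T f ->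
  exists F : R -> R^o, forall t, T t -> is_delta_derivative T F t (f t).
Proof.
move=> [c Tc] frd.
pose fx x : R := f (tsfloor x).
pose leb := @lebesgue_measure R.
pose I (a b : R) : R := \int[leb]_(x in `[a, b[) fx x.
have fi a b : T a -> leb.-integrable `[a, b[ (EFin \o fx).
  move=> Ta; apply: measurable_bounded_integrable => //.
  - by rewrite /leb /= lebesgue_measure_itv/=; case: ifP => _; rewrite ?EFinN// -EFinB ltry.
  - apply: (@measurable_funS _ _ _ _ `[a, +oo[%classic) => //.
      by apply: subset_itvl; rewrite bnd_simp.
    apply: right_continuous_measurable => x ax.
    exact: (tsfloor_right_continuous frd Ta ax).
  have [K K0 hK] := rd_bounded a b frd.
  exists K; split; first exact: num_real.
  move=> M KM x /=; rewrite in_itv/= => /andP[ax xb].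
  have [Tp /andP[ap px] _] := tsfloorP Ta ax.
  rewrite (le_trans _ (ltW KM))//; apply: hK => //.
  by rewrite ap (le_trans px)// ltW.
have Iadd a b d : T a -> a <= b -> b <= d -> I a d = I a b + I b d.
  move=> Ta ab bd; rewrite /I (@itv_bndbnd_setU _ _ _ (BLeft b)) ?bnd_simp//.
  apply: Rintegral_setU => //.
    by rewrite -itv_bndbnd_setU ?bnd_simp//; exact: fi.
  apply/disj_setPS => y [/=]; rewrite 2!in_itv/= => /andP[_ yb] /andP[].
  by rewrite leNgt yb.
have I0 a b : b <= a -> I a b = 0.
  by move=> ba; rewrite /I set_itv_ge ?Rintegral_set0// bnd_simp -leNgt.
have Ile a b v e : T a -> a <= b -> (forall x, a <= x < b -> `|fx x - v| <= e) ->
    `|I a b - (b - a) * v| <= e * (b - a).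
  move=> Ta ab he.
  have mab : fine (leb `[a, b[%classic) = b - a.
    rewrite /leb /= lebesgue_measure_itv/= lte_fin; case: ltP => // ba.
    by rewrite /= (_ : a = b) ?subrr//; apply/le_anti/andP.
  have ci (w : R) : leb.-integrable `[a, b[ (EFin \o cst w).
    apply: measurable_bounded_integrable => //.
    - by rewrite /leb /= lebesgue_measure_itv/=; case: ifP => _; rewrite ?EFinN// -EFinB ltry.
    - exists `|w|; split; first exact: num_real.
      by move=> M wM x _; exact: ltW.
  have <- : \int[leb]_(x in `[a, b[) (fx x - v) = I a b - (b - a) * v.
    rewrite RintegralB//; [|exact: fi|exact: ci].
    by rewrite Rintegral_cst// mab [_ * v]mulrC.
  have di : leb.-integrable `[a, b[ (EFin \o (fun x => fx x - v)).
    by apply: (integrableB _ (fi a b Ta) (ci v)).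
  apply: le_trans (le_normr_Rintegral _ _) _ => //.
  rewrite -mab -Rintegral_cst//; apply: le_Rintegral => //.
  - exact: integrable_norm.
  - exact: ci.
(* The integral over an empty interval is 0, so at most one term survives and [F] is the signed
   integral from [c], on either side of [c]. *)
pose F t : R^o := I c t - I t c.
have FB s t : T s -> T t -> s <= t -> F t - F s = I s t.
  move=> Ts Tt st; rewrite /F.
  have [cs|sc] := leP c s.
    rewrite (Iadd c s t)// (I0 t c) ?(I0 s c)//; first by ring.
    exact: le_trans st.
  have [ct|tc] := leP c t.
    by rewrite (I0 t c ct) (I0 c s (ltW sc)) (Iadd s c t Ts (ltW sc) ct); ring.
  by rewrite (Iadd s t c Ts st (ltW tc)) (I0 c t (ltW tc)) (I0 c s (ltW sc)); ring.
have FBle s t v e : T s -> T t -> (forall x, (s <= x < t) || (t <= x < s) -> `|fx x - v| <= e) ->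
    `|F t - F s - (t - s) * v| <= e * `|t - s|.
  move=> Ts Tt; have [st|/ltW ts] := leP s t => he.
    rewrite FB// (@ger0_norm _ (t - s)) ?subr_ge0//; apply: Ile => // x xst.
    by apply: he; rewrite xst.
  rewrite (_ : _ - _ = - (F s - F t - (s - t) * v)); last by ring.
  rewrite normrN.
  rewrite FB// (@ler0_norm _ (t - s)) ?subr_le0// opprB; apply: Ile => // x xst.
  by apply: he; rewrite xst orbT.
exists F => t Tt; apply/(is_delta_derivativeP Tt); split.
  (* The error bound is 0 here: [fx] equals [f t] on all of [[t, sigma T t)]. *)
  have := FBle t (sigma T t) (f t) 0 Tt (sigma_mem Tcl Tunb t).
  rewrite mul0r normr_le0 subr_eq0 => /(_ _)/eqP h.
  rewrite -[LHS](subrKC (F t)) h// => x.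
  case/orP => /andP[h1 h2]; last by have := sigma_ge Tunb t; lra.
  by rewrite /fx (tsfloor_eq Tt h1 (or_introl h2)) subrr normr0.
move=> e e0.
have [cs|ts] := leP (sigma T t) t.
  have sE : sigma T t = t by apply/le_anti; rewrite cs sigma_ge.
  (* Right-dense case: the floors of points between [s] and [t] also lie between them, within reach
     of the continuity of [f] at [t]. *)
  have /cvg_withinP/(_ e e0)[d d0 hd] := frd.1 t (conj Tt sE).
  exists d => // s Ts sd; rewrite sE; apply: FBle => // x.
  case/orP => /andP[h1 h2].
    have [Tp /andP[sp px] _] := tsfloorP Ts h1.
    rewrite distrC; apply: hd => //; move: sd; rewrite !ltr_norml; lra.
  have [Tp /andP[tp px] _] := tsfloorP Tt h1.
  rewrite distrC; apply: hd => //; move: sd; rewrite !ltr_norml; lra.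
have [d d0 [K K0 hd]] := rd_locally_bounded t frd.
pose K2 := K + `|f t|.
have K20 : 0 < K2 by rewrite ltr_pwDl.
(* Right-scattered case: nearby points of [T] are at most [t], so [sigma T t - s] is at least
   [mu T t > 0]. Boundedness of [f] then suffices once [K2 * (t - s) <= e * mu T t]. *)
pose q := Num.min d (Num.min (sigma T t - t) (e * (sigma T t - t) / K2)).
have q0 : 0 < q by rewrite !lt_min d0 subr_gt0 ts divr_gt0// mulr_gt0// subr_gt0.
exists q => // s Ts; rewrite !lt_min => /and3P[sd sm se].
have st : s <= t.
  rewrite leNgt; apply/negP => tls.
  by have := sigma_le Tunb Ts tls; move: sm; rewrite ltr_norml; lra.
apply: (@le_trans _ _ (K2 * `|t - s|)).
  apply: FBle => // x; case/orP => /andP[h1 h2]; last by lra.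
  have [Tp /andP[sp px] _] := tsfloorP Ts h1.
  rewrite (le_trans (ler_normB _ _))// lerD2r; apply: hd => //.
  by move: sd; rewrite !ltr_norml; lra.
move: se; rewrite ltr_pdivlMr// mulrC distrC => /ltW /le_trans; apply.
by rewrite ler_pM2l// ger0_norm; lra.
Qed.

End DeltaAntiderivative.

(** * Linear systems and transition matrices *)

Section MatrixConvergence.
Context {R : realType} {U : Type} {F : set_system U} {FF : Filter F}.

Lemma cvg_mxP m n (X : U -> 'M[R]_(m, n)) (L : 'M[R]_(m, n)) :
  X @ F --> L <-> forall i j, (fun u => X u i j) @ F --> L i j.
Proof.
split=> [h i j|h].
  exact: (cvg_comp _ _ h (@coord_continuous R m n i j L)).
apply/cvgrPdist_le => e e0.
have : \forall u \near F, forall i j, `|L i j - X u i j| <= e.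
  by apply: filter_forall => i; apply: filter_forall => j; by have /cvgrPdist_le/(_ e e0) := h i j.
by apply: filterS => u hu; apply/norm_mx_le => [|i j]; [exact: ltW|rewrite !mxE].
Qed.

Lemma cvg_mulmx m n p (X : U -> 'M[R]_(m, n)) (Y : U -> 'M[R]_(n, p))
    (L : 'M[R]_(m, n)) (M : 'M[R]_(n, p)) :
  X @ F --> L -> Y @ F --> M -> (fun u => X u *m Y u) @ F --> L *m M.
Proof.
move=> /cvg_mxP hX /cvg_mxP hY; apply/cvg_mxP => i j.
under eq_fun do rewrite mxE; rewrite mxE.
by apply: cvg_big => [|k _]; [exact: add_continuous|exact: (@cvgM R)].
Qed.

Lemma cvg_trmx m n (X : U -> 'M[R]_(m, n)) (L : 'M[R]_(m, n)) :
  X @ F --> L -> (fun u => (X u)^T) @ F --> L^T.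
Proof.
move=> /cvg_mxP hX; apply/cvg_mxP => i j.
by under eq_fun do rewrite mxE; rewrite mxE; exact: hX.
Qed.

Lemma cvg_det n (X : U -> 'M[R]_n) (L : 'M[R]_n) :
  X @ F --> L -> (fun u => \det (X u)) @ F --> \det L.
Proof.
move=> /cvg_mxP hX; rewrite /determinant.
apply: cvg_big => [|s _]; first exact: add_continuous.
apply: (@cvgM R); first exact: cvg_cst.
by apply: cvg_big => [|i _]; [exact: mul_continuous|exact: hX].
Qed.

Lemma cvg_invmx n (X : U -> 'M[R]_n) (L : 'M[R]_n) :
  L \in unitmx -> (\forall u \near F, X u \in unitmx) ->
  X @ F --> L -> (fun u => invmx (X u)) @ F --> invmx L.
Proof.
move=> Lu Xu hX.
(* [invmx] returns a singular matrix unchanged, so the adjugate formula is available only where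
   [X u] is invertible. *)
have E : {near F, (fun u => (\det (X u))^-1 *: \adj (X u)) =1 (fun u => invmx (X u))}.
  by apply: filterS Xu => u Xu; rewrite /invmx Xu.
apply: cvg_trans (near_eq_cvg E) _.
rewrite /invmx Lu; apply/cvg_mxP => i j.
under eq_fun do rewrite !mxE; rewrite !mxE.
apply: (@cvgM R).
  apply: cvgV; last exact: cvg_det.
  by rewrite -unitfE -unitmxE.
rewrite /cofactor; apply: (@cvgM R); first exact: cvg_cst.
apply: cvg_det; apply/cvg_mxP => a b.
under eq_fun do rewrite !mxE; rewrite !mxE.
by move/cvg_mxP : hX; apply.
Qed.

End MatrixConvergence.

Lemma norm_mulmx_le (R : realType) m n p (M : 'M[R]_(m, n)) (N : 'M[R]_(n, p)) :
  `|M *m N| <= n%:R * `|M| * `|N|.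
Proof.
apply/norm_mx_le => [|i j]; first by rewrite !mulr_ge0.
rewrite mxE (le_trans (ler_norm_sum _ _ _))//.
rewrite -mulrA -[X in X%:R * _](card_ord n) mulr_natl -sumr_const.
apply: ler_sum => k _; rewrite normrM.
by apply: ler_pM => //; exact: (proj1 (norm_mx_le _ (normr_ge0 _)) (lexx _)).
Qed.

(** * Rd-continuous matrix functions and uniqueness for linear dynamic equations *)

Section TimeScaleSystem.
Variables (R : realType) (T : set R).
Hypotheses (Tcl : closed T) (Tunb : ~ has_ubound T).
Implicit Types t s : R.

Lemma rd_continuous_mulmx m n p (X : R -> 'M[R]_(m, n)) (Y : R -> 'M[R]_(n, p)) :
  rd_continuous T X -> rd_continuous T Y -> rd_continuous T (fun t => X t *m Y t).
Proof.
move=> [Xr Xl] [Yr Yl]; split=> t ht; first by apply: cvg_mulmx; [exact: Xr|exact: Yr].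
have [l hl] := Xl t ht; have [k hk] := Yl t ht.
by exists (l *m k); exact: cvg_mulmx.
Qed.

Lemma rd_continuous_trmx m n (X : R -> 'M[R]_(m, n)) :
  rd_continuous T X -> rd_continuous T (fun t => (X t)^T).
Proof.
move=> [Xr Xl]; split=> t ht; first by apply: cvg_trmx; exact: Xr.
by have [l hl] := Xl t ht; exists l^T; exact: cvg_trmx.
Qed.

Lemma rd_continuous_entry m n (X : R -> 'M[R]_(m, n)) i j :
  rd_continuous T X -> rd_continuous T (fun t => X t i j : R^o).
Proof.
move=> [Xr Xl]; split=> t ht; first by have /cvg_mxP := Xr t ht; apply.
by have [l /cvg_mxP hl] := Xl t ht; exists (l i j); exact: hl.
Qed.

Lemma rd_continuous_cst (V : normedModType R) (c : V) : rd_continuous T (fun=> c).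
Proof. by split=> t _; [exact: cvg_cst|exists c; exact: cvg_cst]. Qed.

Lemma within_left_subset t : within T t^'- `=>` within T (nbhs t).
Proof.
move=> P /near_withinP[d d0 hd]; apply/nbhs_ballP; exists d => //= s sd _ Ts.
by apply: hd; rewrite // distrC.
Qed.

Lemma rd_continuous_within (V : normedModType R) (f : R -> V) :
  (forall t, T t -> f @ within T (nbhs t) --> f t) -> rd_continuous T f.
Proof.
move=> h; split=> [t [Tt _]|t [Tt _ _]]; first exact: h.
exists (f t); apply: cvg_trans (h t Tt); exact: cvg_app (@within_left_subset t).
Qed.

(** Near a right-dense [t], jumps are trapped below a point [r] of [T] just beyond [t]. For [s < t]
    one has [s <= sigma T s <= t], so at a left-dense [t] the left limit is [f t], which may differ
    from [f (sigma T t)]. *)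
Lemma rd_continuous_sigma (V : normedModType R) (f : R -> V) :
  (forall t, T t -> f @ within T (nbhs t) --> f t) ->
  rd_continuous T (fun t => f (sigma T t)).
Proof.
move=> h; split=> [t [Tt sE]|t [Tt _ _]].
  rewrite sE; apply/cvg_withinP => e e0.
  have /cvg_withinP/(_ e e0)[d d0 hd] := h t Tt.
  have [r [Tr tr]] := sigma_adherent Tunb t d0; rewrite sE => rd.
  exists (Num.min d (r - t)); first by rewrite lt_min d0 subr_gt0.
  move=> s Ts; rewrite lt_min => /andP[sd sr]; apply: hd; first exact: sigma_mem.
  have s1 := sigma_ge Tunb s.
  have s2 : sigma T s <= r by apply: sigma_le => //; move: sr; rewrite ltr_norml; lra.
  by move: sd; rewrite !ltr_norml; lra.
exists (f t); apply/cvgrPdist_le => e e0.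
have /cvg_withinP/(_ e e0)[d d0 hd] := h t Tt.
apply/nbhs_ballP; exists d => //= s sd st Ts; apply: hd; first exact: sigma_mem.
have s1 := sigma_ge Tunb s; have s2 := sigma_le Tunb Tt st.
by move: sd; rewrite /ball /= !ltr_norml; lra.
Qed.

Lemma mx_antiderivative m n (M : R -> 'M[R]_(m, n)) : T !=set0 -> rd_continuous T M ->
  exists F : R -> 'M[R]_(m, n), forall t, T t -> is_delta_derivative T F t (M t).
Proof.
move=> T0 Mrd.
have /choice[f hf] : forall ij : 'I_m * 'I_n, exists F : R -> R^o, forall t, T t ->
    is_delta_derivative T F t (M t ij.1 ij.2).
  by move=> ij; apply: rd_antiderivative => //; exact: rd_continuous_entry.
exists (fun t => \matrix_(i, j) f (i, j) t) => t Tt; apply/delta_mxP => i j.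
by under [X in is_delta_derivative _ X]eq_fun do rewrite mxE; exact: (hf (i, j)).
Qed.

(* With K a bound on A near c and S the supremum of |x| near c, the mean value
   inequality gives S <= n K S d, where n K d <= 1/2. *)
Lemma linear_locally_zero n q (A : R -> 'M[R]_n) (x : R -> 'M[R]_(n, q)) c :
  rd_continuous T A -> (forall t, T t -> is_delta_derivative T x t (A t *m x t)) ->
  T c -> x c = 0 ->
  exists2 d, 0 < d & forall s, T s -> `|s - c| < d -> x s = 0.
Proof.
move=> Ard hx Tc xc.
have [d1 d10 [K K0 hK]] := rd_locally_bounded Tcl Tunb c Ard.
have /cvg_withinP/(_ 1 ltr01)[d2 d20 hd2] := delta_cvg Tunb Tc (hx c Tc).
(* The [+ 1] keeps [q1] positive when [n = 0]. *)
pose q1 := n%:R * K + 1.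
have q10 : 0 < q1 by rewrite ltr_wpDl// mulr_ge0// ltW.
pose d := Num.min d1 (Num.min d2 (1 / (2 * q1))).
have d0 : 0 < d by rewrite !lt_min d10 d20 divr_gt0// mulr_gt0.
exists d => //.
pose S := [set `|x s| | s in [set s | T s /\ `|s - c| < d]].
have Sb : has_ubound S.
  exists 1 => _ [s [Ts +] <-]; rewrite !lt_min => /and3P[_ sd _].
  by have := hd2 s Ts sd; rewrite xc sub0r normrN.
have xS s : T s -> `|s - c| < d -> `|x s| <= sup S.
  by move=> Ts sd; apply: ub_le_sup => //; exists s.
have S0 : 0 <= sup S.
  by apply: le_trans (normr_ge0 (x c)) (xS c Tc _); rewrite subrr normr0.
have step a b : T a -> T b -> a <= b -> `|a - c| < d -> `|b - c| < d ->
    `|b - a| < d -> `|x b - x a| <= sup S / 2.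
  move=> Ta Tb ab ad bd bad.
  have le : `|x b - x a| <= n%:R * K * sup S * (b - a).
    apply: (delta_norm_mvt Tcl Tunb hx) => //; first by rewrite !mulr_ge0// ltW.
    move=> t Tt /andP[at_ tb].
    have td : `|t - c| < d by move: ad bd; rewrite !ltr_norml; lra.
    rewrite (le_trans (norm_mulmx_le _ _))//.
    apply: ler_pM => //.
      by rewrite ler_wpM2l// hK//; move: td; rewrite !lt_min => /andP[].
    exact: xS.
  rewrite (le_trans le)//.
  have : (b - a) * q1 <= 1 / 2.
    move: bad; rewrite !lt_min => /and3P[_ _ bad].
    have := le_lt_trans (ler_norm _) bad.
    by rewrite ltr_pdivlMr ?mulr_gt0//; lra.
  by rewrite /q1; have := ltW K0; nra.
have Sle : sup S <= sup S / 2.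
  apply: ge_sup; first by exists `|x c|, c => //; rewrite /= subrr normr0.
  move=> _ [s [Ts sd] <-].
  have [cs|/ltW sc] := leP c s.
    by have := step c s Tc Ts cs; rewrite xc subr0 subrr normr0; apply.
  have := step s c Ts Tc sc; rewrite xc sub0r normrN subrr normr0 distrC.
  by apply; rewrite // distrC.
move=> s Ts sd; apply/normr0_eq0/le_anti; rewrite normr_ge0 andbT.
by rewrite (le_trans (xS s Ts sd))//; lra.
Qed.

(** Real induction in both directions on the closed zero set of [x]. Zeros spread to neighbours at
    dense points and across jumps at scattered ones; crossing a jump backwards inverts
    [1%:M + mu T r *: A r], which is regressivity. *)
Lemma linear_unique n q (A : R -> 'M[R]_n) (x : R -> 'M[R]_(n, q)) s :
  rd_continuous T A -> regressive T A ->
  (forall t, T t -> is_delta_derivative T x t (A t *m x t)) ->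
  T s -> x s = 0 -> forall t, T t -> x t = 0.
Proof.
move=> Ard Areg hx Ts xs t Tt.
pose f r : R^o := `|x r|.
pose P := T `&` f @^-1` [set y | y <= 0].
have Pcl : closed P.
  apply: closed_preimage_within => // r Tr.
  exact: (cvg_norm (delta_cvg Tunb Tr (hx r Tr))).
have PE r : P r <-> T r /\ x r = 0.
  rewrite /P /f /=; split=> -[Tr]; first by rewrite normr_le0 => /eqP.
  by move=> ->; rewrite normr0.
have Ps : P s by apply/PE.
have stepE r : T r -> x (sigma T r) = (1%:M + mu T r *: A r) *m x r.
  move=> Tr; rewrite (delta_step Tr (hx r Tr)).
  by rewrite mulmxDl mul1mx scalemxAl.
suff : P t by case/PE.
have [st|/ltW ts] := leP s t.
  apply: (closed_real_induction Pcl st Ps) => c /PE[Tc xc] /andP[sc ct].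
  have [cs|cs] := ltP c (sigma T c).
    exists (sigma T c); split => //; last exact: sigma_le.
    by apply/PE; split; [exact: sigma_mem|rewrite stepE// xc mulmx0].
  have sE : sigma T c = c by apply/le_anti; rewrite cs sigma_ge.
  have [d d0 hd] := linear_locally_zero Ard hx Tc xc.
  have md : 0 < Num.min d (t - c) by rewrite lt_min d0 subr_gt0.
  have [r [Tr cr]] := sigma_adherent Tunb c md.
  rewrite sE addrC -ltrBlDr lt_min => /andP[rd rt].
  exists r; split => //; last by lra.
  by apply/PE; split => //; apply: hd => //; rewrite gtr0_norm ?subr_gt0.
apply: (closed_real_induction_down Pcl ts Ps) => c /PE[Tc xc] /andP[tc cs].
have [h|[r [Tr rc sE]]|[_ h]] := left_cases Tcl Tunb Tc.
- by have := h t Tt; rewrite leNgt tc.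
- exists r; split => //.
    apply/PE; split => //; apply: (can_inj (mulKmx (Areg r Tr))).
    by rewrite mulmx0 -stepE// sE.
  by rewrite leNgt; apply/negP => rt; have := sigma_le Tunb Tt rt; rewrite sE leNgt tc.
- have [d d0 hd] := linear_locally_zero Ard hx Tc xc.
  have md : 0 < Num.min d (c - t) by rewrite lt_min d0 subr_gt0.
  have [r [Tr rd rc]] := h _ md.
  move: rd; rewrite ltrBlDr -ltrBlDl lt_min => /andP[rd rt].
  exists r; split => //; last by lra.
  by apply/PE; split => //; apply: hd => //; rewrite ltr0_norm ?subr_lt0// opprB.
Qed.

(** * Cocycle law and continuity of the transition matrix *)

Section TransitionMatrix.
Variables (n : nat) (A : R -> 'M[R]_n) (Phi : R -> R -> 'M[R]_n).
Hypotheses (Ard : rd_continuous T A) (Areg : regressive T A).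
Hypothesis PhiA : is_transition_matrix T A Phi.

(** As functions of [t], both sides solve the same linear equation and agree at [t = r]. *)
Lemma transition_cocycle t r s : T t -> T r -> T s ->
  Phi t r *m Phi r s = Phi t s.
Proof.
move=> Tt Tr Ts; have [_ hs] := PhiA Ts; have [Prr hr] := PhiA Tr.
pose x v := Phi v s + Phi v r *m (- Phi r s).
have hx v : T v -> is_delta_derivative T x v (A v *m x v).
  move=> Tv; rewrite /x mulmxDr mulmxA; apply: deltaD; first exact: hs.
  by apply: delta_mulmxr => //; exact: hr.
have xr : x r = 0 by rewrite /x Prr mul1mx subrr.
apply/esym/eqP; rewrite -subr_eq0 -mulmxN; apply/eqP.
exact: (linear_unique Ard Areg hx Tr xr Tt).
Qed.

Lemma transitionK t s : T t -> T s -> Phi t s *m Phi s t = 1%:M.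
Proof. by move=> Tt Ts; rewrite transition_cocycle//; case: (PhiA Tt). Qed.

Lemma transition_cvg t s : T t -> T s ->
  (fun v => Phi v s) @ within T (nbhs t) --> Phi t s.
Proof.
by move=> Tt Ts; have [_ hs] := PhiA Ts; exact: (delta_cvg Tunb Tt (hs t Tt)).
Qed.

(** Continuity in the second argument comes from the first, since [Phi s v] is the inverse of
    [Phi v s]. *)
Lemma transition_cvg_inv t s : T t -> T s ->
  Phi s @ within T (nbhs t) --> Phi s t.
Proof.
move=> Tt Ts.
have U v : T v -> Phi v s \in unitmx.
  by move=> Tv; have /mulmx1_unit[] := transitionK Tv Ts.
have E v : T v -> invmx (Phi v s) = Phi s v.
  by move=> Tv; rewrite -[LHS]mulmx1 -(transitionK Tv Ts) mulKmx ?U.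
rewrite -(E t Tt).
have nT (P : R -> Prop) : (forall v, T v -> P v) -> \forall v \near within T (nbhs t), P v.
  by move=> h; apply/near_withinP; exists 1 => // v Tv _; exact: h.
apply: (cvg_trans _ (cvg_invmx (U t Tt) (nT _ U) (transition_cvg Tt Ts))).
apply: near_eq_cvg; exact: nT.
Qed.

End TransitionMatrix.

End TimeScaleSystem.

(** * Ranks of families of matrices *)

(* A list whose span has maximal rank. *)
Lemma spanning_list (F : fieldType) (I : eqType) (T : I -> Prop) (q n : nat)
    (M : I -> 'M[F]_(q, n)) :
  exists2 l : seq I, (forall t, t \in l -> T t) &
    forall t, T t -> (M t <= \sum_(i <- l) << M i >>)%MS.
Proof.
pose P r := `[< exists2 l : seq I, (forall t, t \in l -> T t) &
  \rank (\sum_(i <- l) << M i >>)%MS = r >].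
have exP : exists r, P r by exists (\rank (0 : 'M[F]_n)); apply/asboolP; exists [::]; rewrite ?big_nil.
have ubP r : P r -> (r <= n)%N by move=> /asboolP[l _ <-]; exact: rank_leq_col.
case: (ex_maxnP exP ubP) => r /asboolP[l lT lr] rmax.
exists l => // t Tt.
have sub : (\sum_(i <- l) << M i >> <= \sum_(i <- t :: l) << M i >>)%MS.
  by rewrite big_cons addsmxSr.
have : (\sum_(i <- t :: l) << M i >> <= \sum_(i <- l) << M i >>)%MS.
  rewrite -(geq_leqif (mxrank_leqif_sup sub)) lr; apply: rmax; apply/asboolP.
  by exists (t :: l) => // s; rewrite inE => /predU1P[->|/lT].
by apply: submx_trans; rewrite big_cons -(genmxE (M t)) addsmxSl.
Qed.

(** The columns of [cokermx U] are killed by [U], so the cokernel vanishes. *)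
Lemma row_full_kernel (F : fieldType) (k n : nat) (U : 'M[F]_(k, n)) :
  (forall v : 'cV[F]_n, U *m v = 0 -> v = 0) -> row_full U.
Proof.
move=> h; have /eqP : cokermx U = 0.
  apply/matrixP => i j; have := h (col j (cokermx U)).
  by rewrite colE mulmxA mulmx_coker mul0mx -colE => /(_ erefl)/colP/(_ i); rewrite !mxE.
by rewrite -mxrank_eq0 mxrank_coker subn_eq0 col_leq_rank.
Qed.

(** Every matrix in the span is a sum of products [D *m M t] with [t] in [l]; this induction spares
    explicit coefficients. *)
Lemma sum_genmx_ind (F : fieldType) (I : eqType) (q n : nat) (M : I -> 'M[F]_(q, n))
    (l : seq I) (k : nat) (P : 'M[F]_(k, n) -> Prop) :
  P 0 -> (forall X Y, P X -> P Y -> P (X + Y)) ->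
  (forall t D, t \in l -> P (D *m M t)) ->
  forall X, (X <= \sum_(i <- l) << M i >>)%MS -> P X.
Proof.
move=> P0 PD PM; elim: l PM => [_ X|t l IH PM X].
  by rewrite big_nil submx0 => /eqP->.
rewrite big_cons => /sub_addsmxP[[u w] /= ->]; apply: PD; last first.
  apply: IH => [s D sl|]; last exact: submxMl.
  by apply: PM; rewrite inE sl orbT.
have : (u *m << M t >> <= M t)%MS by rewrite (submx_trans (submxMl _ _))// genmxE.
by case/submxP => D ->; apply: PM; rewrite mem_head.
Qed.

Lemma spanning_list_kernel (F : fieldType) (I : eqType) (q n : nat)
    (M : I -> 'M[F]_(q, n)) (l : seq I) :
  row_full (\sum_(i <- l) << M i >>)%MS ->
  forall v : 'cV[F]_n, (forall t, t \in l -> M t *m v = 0) -> v = 0.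
Proof.
move=> full v hv; rewrite -[v]mul1mx.
apply: (sum_genmx_ind (M := M) (l := l) (P := fun X => X *m v = 0)).
- exact: mul0mx.
- by move=> X Y X0 Y0; rewrite mulmxDl X0 Y0 addr0.
- by move=> t D tl; rewrite -mulmxA hv// mulmx0.
- exact: submx_full.
Qed.

Lemma spanning_list_full (F : fieldType) (I : eqType) (q n : nat) (T : I -> Prop)
    (M : I -> 'M[F]_(q, n)) (l : seq I) :
  (forall t, T t -> (M t <= \sum_(i <- l) << M i >>)%MS) ->
  (forall v : 'cV[F]_n, (forall t, T t -> M t *m v = 0) -> v = 0) ->
  row_full (\sum_(i <- l) << M i >>)%MS.
Proof.
move=> hM ker; apply: row_full_kernel => v Uv; apply: ker => t /hM/submxP[D ->].
by rewrite -mulmxA Uv mulmx0.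
Qed.

(** The identity lies in the span of the [C t], which yields one [Y] with [B s = Y *m B' s] for all
    [s]. A vector killed by [Y^T] is then killed by every [(B s)^T], so [Y] has rank [n]. *)
Lemma kernel_factor_dim (F : fieldType) (I : eqType) (T : I -> Prop) (p n m k : nat)
    (C : I -> 'M[F]_(p, n)) (B : I -> 'M[F]_(n, m))
    (C' : I -> 'M[F]_(p, k)) (B' : I -> 'M[F]_(k, m)) :
  (forall t s, T t -> T s -> C t *m B s = C' t *m B' s) ->
  (forall v : 'cV[F]_n, (forall t, T t -> C t *m v = 0) -> v = 0) ->
  (forall v : 'cV[F]_n, (forall t, T t -> (B t)^T *m v = 0) -> v = 0) ->
  (n <= k)%N.
Proof.
move=> CB kerC kerB.
have [lC lCT hC] := spanning_list T C.
have fullC := spanning_list_full hC kerC.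
(* The factor [1%:M] is the place where the induction over the span substitutes [X]. *)
have [Y hY] : exists Y : 'M[F]_(n, k), forall s, T s -> 1%:M *m B s = Y *m B' s.
  apply: (sum_genmx_ind (M := C) (l := lC)
    (P := fun X => exists Y : 'M[F]_(n, k), forall s, T s -> X *m B s = Y *m B' s)).
  - by exists 0 => s _; rewrite !mul0mx.
  - move=> X1 X2 [Y1 h1] [Y2 h2]; exists (Y1 + Y2) => s Ts.
    by rewrite !mulmxDl h1// h2.
  - by move=> t D /lCT Tt; exists (D *m C' t) => s Ts; rewrite -!mulmxA CB.
  - exact: submx_full.
have : row_full Y^T.
  apply: row_full_kernel => v Yv; apply: kerB => t Tt.
  by rewrite -[B t]mul1mx hY// trmx_mul -mulmxA Yv mulmx0.
by rewrite -col_leq_rank => /leq_trans; apply; exact: rank_leq_row.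
Qed.

(** [T] may be bounded below, so the lower bound is taken among [s0] and the points of the list. *)
Lemma common_lower (R : realType) (T : set R) (s0 : R) (l : seq R) : T s0 ->
  (forall t, t \in l -> T t) ->
  exists2 t0, T t0 & forall t, t \in l -> t0 <= t.
Proof.
move=> Ts0; elim: l => [|a l IH] lT; first by exists s0.
have [|t0 Tt0 ht0] := IH; first by move=> t tl; apply: lT; rewrite inE tl orbT.
exists (Num.min a t0) => [|t].
  by case: (leP a t0) => _ //; apply: lT; rewrite mem_head.
by rewrite inE ge_min => /predU1P[->|/ht0->]; rewrite ?lexx ?orbT.
Qed.

Lemma common_upper (R : realType) (l : seq R) :
  exists b, forall t, t \in l -> t <= b.
Proof.
elim: l => [|a l [b hb]]; first by exists 0.
exists (Num.max a b) => t.
by rewrite inE le_max => /predU1P[->|/hb->]; rewrite ?lexx ?orbT.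
Qed.

(** * Controllability and observability *)

Section Realization.
Variables (R : realType) (T : set R) (n m p : nat).
Variables (A : R -> 'M[R]_n) (B : R -> 'M[R]_(n, m)) (C : R -> 'M[R]_(p, n)).
Variables (Phi : R -> R -> 'M[R]_n) (s0 : R).
Hypotheses (Tcl : closed T) (Tunb : ~ has_ubound T).
Hypothesis hABC : regressive_system T A B C.
Hypothesis PhiA : is_transition_matrix T A Phi.
Hypothesis Ts0 : T s0.

Let Ard : rd_continuous T A. Proof. by case: hABC. Qed.
Let Areg : regressive T A. Proof. by case: hABC. Qed.

(* The input and output matrices in the coordinates z(t) = Phi(s0, t) x(t). *)
Definition pulled_input t := Phi s0 (sigma T t) *m B t.
Definition pulled_output t := C t *m Phi t s0.

Lemma rd_continuous_pulled_input : rd_continuous T pulled_input.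
Proof.
apply: rd_continuous_mulmx; last by case: hABC.
apply: (rd_continuous_sigma Tcl Tunb (f := Phi s0)) => t Tt.
exact: (transition_cvg_inv Tcl Tunb Ard Areg PhiA).
Qed.

Lemma rd_continuous_pulled_output : rd_continuous T pulled_output.
Proof.
apply: rd_continuous_mulmx; first by case: hABC.
by apply: rd_continuous_within => t Tt; exact: (transition_cvg Tunb PhiA).
Qed.

Lemma weighting_pulled t s : T t ->
  C t *m Phi t (sigma T s) *m B s = pulled_output t *m pulled_input s.
Proof.
move=> Tt; have Ts := sigma_mem Tcl Tunb s.
rewrite -(transition_cocycle Tcl Tunb Ard Areg PhiA Tt Ts0 Ts).
by rewrite /pulled_output /pulled_input !mulmxA.
Qed.

(** The product rule evaluates the first factor at [sigma T t], and [Phi (sigma T t) s0] cancels the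
    [Phi s0 (sigma T t)] inside [pulled_input]. *)
Lemma variation_of_constants (u : R -> 'cV[R]_m) (Z : R -> 'cV[R]_n) (c : 'cV[R]_n) :
  (forall t, T t -> is_delta_derivative T Z t (pulled_input t *m u t)) ->
  state_solution T A B u (fun t => Phi t s0 *m (Z t + c)).
Proof.
move=> hZ t Tt; have [_ hPhi] := PhiA Ts0.
rewrite (_ : A t *m _ + _ = A t *m Phi t s0 *m (Z t + c) +
  Phi (sigma T t) s0 *m (pulled_input t *m u t + 0)); last first.
  rewrite addr0 /pulled_input !mulmxA (transitionK Tcl Tunb Ard Areg PhiA) ?mul1mx//.
  exact: sigma_mem.
apply: (delta_mulmx Tunb Tt (hPhi t Tt)); apply: deltaD; first exact: hZ.
exact: delta_cst.
Qed.

(** The difference is written with the constant factor [- 1%:M], so that the rules for sums and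
    constant multiples apply. *)
Lemma state_solutionB (u : R -> 'cV[R]_m) (x y : R -> 'cV[R]_n) :
  state_solution T A B u x -> state_solution T A B u y ->
  forall t, T t -> is_delta_derivative T (fun s => x s + y s *m (- 1%:M)) t
    (A t *m (x t + y t *m (- 1%:M))).
Proof.
move=> hx hy t Tt.
rewrite (_ : A t *m _ = A t *m x t + B t *m u t +
    (A t *m y t + B t *m u t) *m (- 1%:M)); last first.
  by rewrite !mulmxN !mulmx1 mulmxBr opprD addrACA subrr addr0.
by apply: deltaD; [exact: hx|apply: delta_mulmxr => //; exact: hy].
Qed.

Lemma state_solution_unique (u : R -> 'cV[R]_m) (x y : R -> 'cV[R]_n) s :
  state_solution T A B u x -> state_solution T A B u y ->
  T s -> x s = y s -> forall t, T t -> x t = y t.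
Proof.
move=> hx hy Ts xy t Tt; apply/eqP; rewrite -subr_eq0 -[y t]mulmx1 -mulmxN; apply/eqP.
apply: (linear_unique Tcl Tunb Ard Areg (state_solutionB hx hy) Ts) => //.
by rewrite mulmxN mulmx1 xy subrr.
Qed.

Lemma zero_input_solution (c : 'cV[R]_n) :
  state_solution T A B (fun=> 0) (fun t => Phi t s0 *m c).
Proof.
rewrite (_ : (fun t => _) = fun t => Phi t s0 *m (0 + c)); last first.
  by apply/funext => t; rewrite add0r.
by apply: (variation_of_constants (Z := fun=> 0)) => t Tt; rewrite mulmx0; exact: delta_cst.
Qed.

(** The zero-input solutions with coordinates [v] and 0 have the same response, hence the same state
    at [t0], and [Phi t0 s0] is invertible. *)
Lemma observable_kernel t0 tf : T t0 -> observable T A B C t0 tf ->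
  forall v : 'cV[R]_n, (forall t, T t -> pulled_output t *m v = 0) -> v = 0.
Proof.
move=> Tt0 obs v hv.
have /= e := obs _ _ (zero_input_solution v) (zero_input_solution 0).
rewrite -[v]mul1mx -(transitionK Tcl Tunb Ard Areg PhiA Ts0 Tt0) -mulmxA e ?mulmx0//.
by move=> t Tt _; rewrite !mulmxA -/(pulled_output t) hv// mulmx0.
Qed.

(** A zero-input solution is [Phi t s0 *m c]; equal responses put the difference of the two
    constants in the common kernel. *)
Lemma kernel_observable t0 tf : T t0 ->
  (forall v : 'cV[R]_n,
    (forall t, T t -> t0 <= t < tf -> pulled_output t *m v = 0) -> v = 0) ->
  observable T A B C t0 tf.
Proof.
move=> Tt0 ker x1 x2 h1 h2 C12.
pose c (x : R -> 'cV[R]_n) := Phi s0 t0 *m x t0.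
have xE x : state_solution T A B (fun=> 0) x -> forall t, T t -> x t = Phi t s0 *m c x.
  move=> hx; apply: (state_solution_unique hx (zero_input_solution _) Tt0).
  by rewrite /c mulmxA (transitionK Tcl Tunb Ard Areg PhiA)// mul1mx.
rewrite (xE _ h1)// (xE _ h2)//; congr (_ *m _).
apply/eqP; rewrite -subr_eq0; apply/eqP; apply: ker => t Tt ht.
rewrite mulmxBr /pulled_output -!mulmxA -xE// -xE// C12//.
exact: subrr.
Qed.

(** Steering from 0 to [Phi tf s0 *m w] writes [w] as [Z tf - Z t0]. If [v] is orthogonal to every
    input direction, [v^T *m Z t] has zero derivative, so [v] is orthogonal to every [w]. *)
Lemma controllable_kernel t0 tf : T t0 -> T tf -> controllable T A B t0 tf ->
  forall v : 'cV[R]_n, (forall t, T t -> (pulled_input t)^T *m v = 0) -> v = 0.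
Proof.
move=> Tt0 Ttf ctr v hv; apply: trmx_inj; rewrite trmx0.
have vB t : T t -> v^T *m pulled_input t = 0.
  by move=> Tt; rewrite -[LHS]trmxK trmx_mul trmxK hv// trmx0.
suff vw (w : 'cV[R]_n) : v^T *m w = 0.
  by apply/matrixP => i j; have := vw (delta_mx j 0); rewrite -colE => /colP/(_ i); rewrite !mxE.
have [u [x [urd hx x0 xf]]] := ctr 0 (Phi tf s0 *m w).
have [|Z hZ] := mx_antiderivative Tcl Tunb (ex_intro _ s0 Ts0)
    (M := fun t => pulled_input t *m u t).
  by apply: rd_continuous_mulmx => //; exact: rd_continuous_pulled_input.
have xE := state_solution_unique hx (variation_of_constants (- Z t0) hZ) Tt0.
move: xf; rewrite xE//; last by rewrite x0 subrr mulmx0.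
move=> /(congr1 (mulmx (Phi s0 tf))).
rewrite !mulmxA (transitionK Tcl Tunb Ard Areg PhiA)// !mul1mx => <-.
rewrite mulmxBr; apply/eqP; rewrite subr_eq0; apply/eqP.
apply: (delta0_cst Tcl Tunb (x := fun t => v^T *m Z t)) => // t Tt.
have -> : 0 = v^T *m (pulled_input t *m u t) by rewrite mulmxA vB// mul0mx.
by apply: delta_mulmxl => //; exact: hZ.
Qed.

End Realization.

(** Values on [[s, b]] determine the derivative at [s]: through the jump if [s] is right-scattered,
    through points [r] decreasing to [s] otherwise. *)
Lemma delta_locally_cst (R : realType) (T : set R) (Tcl : closed T)
    (Tunb : ~ has_ubound T) (V : normedModType R) (h : R -> V) (s b : R) (l : V) :
  T s -> T b -> s < b -> is_delta_derivative T h s l ->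
  (forall r, T r -> s <= r <= b -> h r = h s) -> l = 0.
Proof.
move=> Ts Tb sb hl hc.
have [ss|ss] := ltP s (sigma T s).
  have := delta_step Ts hl; rewrite hc; last 2 first.
  - exact: sigma_mem.
  - by rewrite (ltW ss) sigma_le.
  rewrite -[X in X = _]addr0 => /addrI/esym/eqP; rewrite scaler_eq0 => /orP[|/eqP//].
  by rewrite /mu subr_eq0 gt_eqF.
have sE : sigma T s = s by apply/le_anti; rewrite ss sigma_ge.
apply: (@normr_le_eps0 _ _ _ 1) => e e0; rewrite mulr1.
have /near_withinP[d d0 hd] := hl e e0.
have md : 0 < Num.min d (b - s) by rewrite lt_min d0 subr_gt0.
have [r [Tr sr]] := sigma_adherent Tunb s md.
rewrite sE addrC -ltrBlDr lt_min => /andP[rd rb].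
have := hd r Tr; rewrite gtr0_norm ?subr_gt0// sE => /(_ rd).
rewrite (hc r) ?(ltW sr)/= //; last by lra.
by rewrite subrr sub0r normrN normrZ mulrC ler_pM2r// normr_gt0 subr_eq0 lt_eqF.
Qed.

Lemma mulmx_trl_ge0 (R : realDomainType) n (y : 'cV[R]_n) : 0 <= (y^T *m y) 0 0.
Proof. by rewrite mxE; apply: sumr_ge0 => i _; rewrite mxE -expr2 sqr_ge0. Qed.

Lemma mulmx_trl_eq0 (R : realDomainType) n (y : 'cV[R]_n) :
  (y^T *m y) 0 0 = 0 -> y = 0.
Proof.
rewrite mxE => /eqP; rewrite psumr_eq0; last first.
  by move=> i _; rewrite mxE -expr2 sqr_ge0.
move=> /allP h; apply/colP => i; have := h i (mem_index_enum _).
by rewrite /= !mxE mulf_eq0 orbb => /eqP.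
Qed.

(* W is the controllability Gramian, the delta integral of B' B'^T over
   [t0, tf).  If W v = 0, then the delta integral of |B'^T v|^2 vanishes. *)
Lemma kernel_controllable (R : realType) (T : set R) (n m p : nat)
    (A : R -> 'M[R]_n) (B : R -> 'M[R]_(n, m)) (C : R -> 'M[R]_(p, n))
    (Phi : R -> R -> 'M[R]_n) (s0 t0 tf : R) :
  closed T -> ~ has_ubound T -> regressive_system T A B C ->
  is_transition_matrix T A Phi -> T s0 -> T t0 -> T tf -> t0 < tf ->
  (forall v : 'cV[R]_n, (forall t, T t -> t0 <= t < tf ->
     (pulled_input T B Phi s0 t)^T *m v = 0) -> v = 0) ->
  controllable T A B t0 tf.
Proof.
move=> Tcl Tunb hABC PhiA Ts0 Tt0 Ttf tt ker.
have [Ard _ _ Areg] := hABC.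
pose Bp := pulled_input T B Phi s0.
have Brd : rd_continuous T Bp := rd_continuous_pulled_input Tcl Tunb hABC PhiA Ts0.
have [|F hF] := mx_antiderivative Tcl Tunb (ex_intro _ s0 Ts0)
    (M := fun t => Bp t *m (Bp t)^T).
  by apply: rd_continuous_mulmx => //; exact: rd_continuous_trmx.
pose W := F tf - F t0.
have Wu : W \in unitmx.
  rewrite -row_full_unit; apply: row_full_kernel => v Wv.
  (* The minus sign makes the derivative of [g] nonpositive, as [delta_le_mvt] with [L = 0] requires
     for monotonicity. *)
  pose g t : R^o := ((- v)^T *m F t *m v) 0 0.
  pose y t := (Bp t)^T *m v.
  have gramE (Q : 'M[R]_(n, m)) :
      ((- v)^T *m (Q *m Q^T) *m v) 0 0 = - ((Q^T *m v)^T *m (Q^T *m v)) 0 0.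
    by rewrite (trmx_mul Q^T) trmxK raddfN !mulNmx mxE !mulmxA.
  have hg t : T t -> is_delta_derivative T g t (- ((y t)^T *m y t) 0 0).
    move=> Tt; rewrite -gramE.
    have /delta_mxP/(_ 0 0) := delta_mulmxr Tunb v Tt (delta_mulmxl Tunb (- v)^T Tt (hF t Tt)).
    exact.
  have gle a b : T a -> T b -> a <= b -> g b <= g a.
    move=> Ta Tb ab; have := delta_le_mvt Tcl Tunb (L := 0) hg Ta Tb ab.
    rewrite mul0r subr_le0; apply => t _ _.
    by rewrite oppr_le0; exact: mulmx_trl_ge0.
  have gE : g t0 = g tf.
    have Fv : F tf *m v = F t0 *m v by apply/eqP; rewrite -subr_eq0 -mulmxBl Wv.
    by rewrite /g -!mulmxA Fv.
  (* A nonincreasing [g] with equal end values is constant on [[t0, tf]], and [s < tf] leaves an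
     interval to the right of [s] on which its derivative is read off as 0. *)
  apply: ker => s Ts /andP[t0s stf]; rewrite -/Bp -/(y s).
  apply: mulmx_trl_eq0; apply/eqP; rewrite -oppr_eq0; apply/eqP.
  apply: (delta_locally_cst Tcl Tunb Ts Ttf stf (hg s Ts)) => r Tr /andP[sr rtf].
  apply/le_anti; rewrite gle//= (le_trans (gle _ _ Tt0 Ts t0s))// gE; exact: gle.
move=> x0 xf.
(* With input [(Bp t)^T *m w] the pulled state is [F t *m w + c]: the choice of [c] fits the initial
   state, and [W *m w] supplies the displacement to the final one. *)
pose w := invmx W *m (Phi s0 tf *m xf - Phi s0 t0 *m x0).
pose c := Phi s0 t0 *m x0 - F t0 *m w.
exists (fun t => (Bp t)^T *m w), (fun t => Phi t s0 *m (F t *m w + c)); split.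
- by apply: rd_continuous_mulmx; [exact: rd_continuous_trmx|exact: rd_continuous_cst].
- apply: (variation_of_constants Tcl Tunb hABC PhiA Ts0) => t Tt.
  by rewrite mulmxA; apply: delta_mulmxr => //; exact: hF.
- rewrite /c addrC subrK mulmxA (transitionK Tcl Tunb Ard Areg PhiA)//.
  exact: mul1mx.
- have -> : F tf *m w + c = Phi s0 tf *m xf.
    rewrite /c addrCA -mulmxBl -/W /w mulKVmx//.
    by rewrite addrC subrK.
  rewrite mulmxA (transitionK Tcl Tunb Ard Areg PhiA)//.
  exact: mul1mx.
Qed.

(** For [A = 0] the transition matrix is the identity, so a factorization that separates [t] from
    [s] is already a realization. *)
Lemma factor_realization (R : realType) (T : set R) (m p k : nat)
    (B : R -> 'M[R]_(k, m)) (C : R -> 'M[R]_(p, k)) (G : R -> R -> 'M[R]_(p, m)) :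
  rd_continuous T B -> rd_continuous T C ->
  (forall t s, T t -> T s -> G t s = C t *m B s) ->
  realization T (fun=> 0) B C G.
Proof.
move=> Brd Crd GE; split.
  split=> //; first exact: rd_continuous_cst.
  by move=> t Tt; rewrite scaler0 addr0 unitmx1.
exists (fun _ _ => 1%:M); split; last by move=> t s Tt Ts; rewrite mulmx1 GE.
by move=> s Ts; split=> // t Tt; rewrite mul0mx; exact: delta_cst.
Qed.

Theorem theorem4p4 (R : realType) (T : set R)
  (hT : time_scale T) (hTunb : ~ has_ubound T) (hTmu : bounded_graininess T)
  (n m p : nat)
  (A : R -> 'M[R]_n) (B : R -> 'M[R]_(n, m)) (C : R -> 'M[R]_(p, n))
  (hABC : regressive_system T A B C)
  (G : R -> R -> 'M[R]_(p, m)) (hG : realization T A B C G) :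
  minimal_realization T A B C G <->
  exists t0 tf : R,
    [/\ T t0, T tf, t0 < tf, controllable T A B t0 tf & observable T A B C t0 tf].
Proof.
have [[s0 Ts0] Tcl] := hT.
have [_ [Phi [PhiA GPhi]]] := hG.
pose Bp := pulled_input T B Phi s0; pose Cp := pulled_output C Phi s0.
have Brd : rd_continuous T Bp := rd_continuous_pulled_input Tcl hTunb hABC PhiA Ts0.
have Crd : rd_continuous T Cp := rd_continuous_pulled_output hTunb hABC PhiA Ts0.
have GE t s : T t -> T s -> G t s = Cp t *m Bp s.
  by move=> Tt Ts; rewrite GPhi// (weighting_pulled Tcl hTunb hABC PhiA Ts0).
split=> [[_ hmin]|[t0 [tf [Tt0 Ttf t0f ctr obs]]]]; last first.
  split=> // k kn [A' [B' [C' [hABC' [Phi' [PhiA' GPhi']]]]]].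
  suff : (n <= k)%N by rewrite leqNgt kn.
  apply: (kernel_factor_dim (T := T) (C := Cp) (B := Bp)
    (C' := pulled_output C' Phi' s0) (B' := pulled_input T B' Phi' s0)).
  - move=> t s Tt Ts; rewrite -GE// GPhi'//.
    exact: (weighting_pulled Tcl hTunb hABC' PhiA' Ts0).
  - exact: (observable_kernel Tcl hTunb hABC PhiA Ts0 Tt0 obs).
  - exact: (controllable_kernel Tcl hTunb hABC PhiA Ts0 Tt0 Ttf ctr).
(* Minimality bounds from below the inner dimension of every rd-continuous factorization of the
   weighting pattern. *)
have hmin' r (B' : R -> 'M[R]_(r, m)) (C' : R -> 'M[R]_(p, r)) :
    rd_continuous T B' -> rd_continuous T C' ->
    (forall t s, T t -> T s -> Cp t *m Bp s = C' t *m B' s) -> (n <= r)%N.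
  move=> B'rd C'rd E; rewrite leqNgt; apply/negP => rn; apply: (hmin r rn).
  exists (fun=> 0), B', C'; apply: factor_realization => // t s Tt Ts.
  by rewrite GE// E.
have [lB lBT hB] := spanning_list T (fun t => (Bp t)^T).
have [lC lCT hC] := spanning_list T Cp.
have fullB : row_full (\sum_(i <- lB) << (Bp i)^T >>)%MS.
  set U := (\sum_(i <- lB) _)%MS in hB *; rewrite -col_leq_rank.
  (* [(Bp s)^T] lies in the row space of [U], so it equals [(Bp s)^T *m D *m row_base U];
     transposing gives a factorization through dimension [\rank U]. *)
  pose D := pinvmx (row_base U).
  apply: (hmin' _ (fun s => D^T *m Bp s) (fun t => Cp t *m (row_base U)^T)).
  - by apply: rd_continuous_mulmx => //; exact: rd_continuous_cst.
  - by apply: rd_continuous_mulmx => //; exact: rd_continuous_cst.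
  - move=> t s Tt Ts; rewrite -mulmxA; congr (_ *m _); apply: trmx_inj.
    by rewrite (trmx_mul (row_base U)^T) (trmx_mul D^T) !trmxK mulmxKpV// eq_row_base hB.
have fullC : row_full (\sum_(i <- lC) << Cp i >>)%MS.
  set U := (\sum_(i <- lC) _)%MS in hC *; rewrite -col_leq_rank.
  apply: (hmin' _ (fun s => row_base U *m Bp s) (fun t => Cp t *m pinvmx (row_base U))).
  - by apply: rd_continuous_mulmx => //; exact: rd_continuous_cst.
  - by apply: rd_continuous_mulmx => //; exact: rd_continuous_cst.
  - by move=> t s Tt Ts; rewrite (mulmxA _ (row_base U)) mulmxKpV// eq_row_base hC.
have lT t : t \in lB ++ lC -> T t by rewrite mem_cat => /orP[/lBT|/lCT].
have [t0 Tt0 ht0] := common_lower Ts0 lT.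
have [b hb] := common_upper (lB ++ lC).
(* [tf] lies strictly beyond [b], since both kernel conditions use the half-open interval
   [[t0, tf)]. *)
have [tf Ttf] := unbounded_gt hTunb (Num.max b t0); rewrite gt_max => /andP[btf t0f].
have in_itv t : t \in lB ++ lC -> t0 <= t < tf.
  by move=> tl; rewrite ht0//= (le_lt_trans (hb t tl)).
exists t0, tf; split=> //.
  apply: (kernel_controllable Tcl hTunb hABC PhiA Ts0) => // v hv.
  apply: (spanning_list_kernel fullB) => t tl.
  by apply: hv; [exact: lBT|apply: in_itv; rewrite mem_cat tl].
apply: (kernel_observable Tcl hTunb hABC PhiA Ts0 Tt0) => v hv.
apply: (spanning_list_kernel fullC) => t tl.
by apply: hv; [exact: lCT|apply: in_itv; rewrite mem_cat tl orbT].
Qed.
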